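(* Let $p$ be a stochastic choice function on $X$ and let $M\in\mathcal N$. The following are equivalent: (i) for every MSC $\langle Q,\nu\rangle$ rationalizing $p$, the matrix $Q(M)$ is reversible on $M$; (iii) every cycle on every subset $M'\subseteq M$ that is sign-consistent with respect to $p(\cdot,M)$ satisfies $\delta_{kl}(M)=0$ for all its pairs $(k,l)$; equivalently, there is no subset $M'\subseteq M$ and cycle on $M'$ such that $\delta_{kl}(M)>0$ for all pairs $(k,l)$ of the cycle, nor one such that $\delta_{kl}(M)<0$ for all its pairs.
   Context: $X$ is a finite set of alternatives; a menu is a nonempty subset of $X$, and $\mathcal N$ denotes the set of all menus. A stochastic choice function is a map $p:X\times\mathcal N\to[0,1]$ with $\sum_{i\in M}p(i,M)=1$ and $p(i,M)=0$ for $i\notin M$; $p(\cdot,M)$ denotes the row vector $(p(i,M))_{i\in M}$. For $M\in\mathcal N$ and $i,j\in M$ let $\delta_{ij}(M)=p(i,M)\,p(j,\{i,j\})-p(i,\{i,j\})\,p(j,M)$. An MSC (Markov stochastic choice model) $\langle Q,\nu\rangle$ consists of, for every menu $M$, a matrix $Q(M)=(q_{ij}(M))_{i,j\in M}$ with nonnegative entries and a probability distribution $\nu_M$ on $M$, such that for all $M\in\mathcal N$ and distinct $i,j\in M$: (A1) $q_{ii}(M)=1-\sum_{k\neq i}q_{ik}(M)>0$; (A2) if $q_{ij}(\{i,j\})=0$ then $q_{ji}(\{i,j\})>0$; (A3) $q_{ij}(\{i,j\})\,q_{ji}(M)=q_{ji}(\{i,j\})\,q_{ij}(M)$. For a right stochastic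 matrix $Q$ on $M$ and a distribution $\nu$ on $M$ define $\rho(\nu,Q)=\lim_{\alpha\to0^+}\sum_{t\ge0}\alpha(1-\alpha)^t\nu Q^t$ (the limit exists and satisfies $\rho(\nu,Q)(I-Q)=0$). $p$ is rationalized by the MSC $\langle Q,\nu\rangle$ if $p(\cdot,M)=\rho(\nu_M,Q(M))$ for every $M\in\mathcal N$. $Q(M)$ is reversible on $M$ (for the model $\langle Q,\nu\rangle$) if, with $\rho=\rho(\nu_M,Q(M))$, the detailed balance equations $q_{ji}(M)\rho_j=\rho_i\,q_{ij}(M)$ hold for all $i,j\in M$. A cycle on a set $M'=\{i_1,\dots,i_n\}$ (elements listed in some order, distinct) is the set of ordered pairs $\{(i_1,i_2),(i_2,i_3),\dots,(i_{n-1},i_n),(i_n,i_1)\}$. A cycle on $M'\subseteq M$ is sign-consistent with respect to $p(\cdot,M)$ if $\operatorname{sgn}\delta_{ij}(M)=\operatorname{sgn}\delta_{kl}(M)$ for all pairs $(i,j),(k,l)$ in the cycle. *)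

(* Defs.v *)
From HB Require Import structures.
From mathcomp Require Import all_boot all_order all_algebra.
From mathcomp Require Import all_classical all_reals all_analysis.
Set Implicit Arguments. Unset Strict Implicit. Unset Printing Implicit Defensive.
Import Order.TTheory GRing.Theory Num.Theory.
Import numFieldNormedType.Exports.
Local Open Scope ring_scope.

Section MSC.
Variables (R : realType) (X : finType).

Definition menu (M : {set X}) : bool := M != finset.set0.

Definition stoch_choice (p : X -> {set X} -> R) : Prop :=
  forall M : {set X}, menu M ->
    (forall i, 0 <= p i M <= 1) /\
    (\sum_(i in M) p i M = 1) /\
    (forall i, i \notin M -> p i M = 0).

Definition delta (p : X -> {set X} -> R) (M : {set X}) (i j : X) : R :=
  p i M * p j [set i; j] - p i [set i; j] * p j M.

Definition MSC (Q : {set X} -> X -> X -> R) (nu : {set X} -> X -> R) : Prop :=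
  forall M : {set X}, menu M ->
    (forall i j, i \in M -> j \in M -> 0 <= Q M i j) /\
    (forall i, i \in M -> 0 <= nu M i) /\ (\sum_(i in M) nu M i = 1) /\
    (forall i, i \in M ->
       Q M i i = 1 - \sum_(k in M | k != i) Q M i k /\ 0 < Q M i i) /\
    (forall i j, i \in M -> j \in M -> i != j ->
       Q [set i; j] i j = 0 -> 0 < Q [set i; j] j i) /\
    (forall i j, i \in M -> j \in M -> i != j ->
       Q [set i; j] i j * Q M j i = Q [set i; j] j i * Q M i j).

(* the row vector nu_M Q(M)^t, as a function on X (meaningful on M) *)
Fixpoint nuQt (Q : {set X} -> X -> X -> R) (nu : {set X} -> X -> R)
    (M : {set X}) (t : nat) : X -> R :=
  match t with
  | 0 => fun j => nu M j
  | t'.+1 => fun j => \sum_(i in M) nuQt Q nu M t' i * Q M i j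
  end.

Definition rho (Q : {set X} -> X -> X -> R) (nu : {set X} -> X -> R)
    (M : {set X}) (j : X) : R :=
  lim ((fun a : R =>
          limn (fun n => \sum_(0 <= t < n) a * (1 - a) ^+ t * nuQt Q nu M t j))
       @ at_right (0:R))%classic.

Definition rationalizes (p : X -> {set X} -> R)
    (Q : {set X} -> X -> X -> R) (nu : {set X} -> X -> R) : Prop :=
  forall M : {set X}, menu M -> forall j, j \in M -> p j M = rho Q nu M j.

Definition reversible (Q : {set X} -> X -> X -> R) (nu : {set X} -> X -> R)
    (M : {set X}) : Prop :=
  forall i j, i \in M -> j \in M ->
    Q M j i * rho Q nu M j = rho Q nu M i * Q M i j.

(* the ordered pairs (i1,i2),...,(i_{n-1},i_n),(i_n,i1) of the cycle on the
   distinct elements listed in s *)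
Definition cycle_pairs (s : seq X) : seq (X * X) := zip s (rot 1 s).

(* a cycle on M' ⊆ M, given by a nonempty duplicate-free list s *)
Definition is_cycle_in (M : {set X}) (s : seq X) : Prop :=
  [/\ s != [::], uniq s & {subset s <= M}].

Definition sign_consistent (p : X -> {set X} -> R) (M : {set X}) (s : seq X)
  : Prop :=
  forall a b, a \in cycle_pairs s -> b \in cycle_pairs s ->
    Num.sg (delta p M a.1 a.2) = Num.sg (delta p M b.1 b.2).

End MSC.

(* Main.v *)
Require Import Defs.
From HB Require Import structures.
From mathcomp Require Import all_boot all_order all_algebra.
From mathcomp Require Import all_classical all_reals all_analysis.
From mathcomp Require Import ring lra.
Import Order.TTheory GRing.Theory Num.Theory.
Import numFieldNormedType.Exports.
Local Open Scope ring_scope.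
Set Implicit Arguments.
Unset Strict Implicit.

(** Matching the binary menus with (A3) writes every off-diagonal entry of
    [Q(M)] as [q_ij(M) = l_ij p(j,{i,j})] with symmetric [l_ij >= 0], so the net
    probability flow from [i] to [j] under [p(.,M)] is [l_ij delta_ij(M)].
    Stationarity says that this flow is a circulation, and reversibility that it
    vanishes. A nonzero circulation contains a cycle of positive [delta];
    conversely, on a cycle of positive [delta] the weights [l_ij] proportional to
    [1 / |delta_ij|] on the arcs yield a nonzero circulation, and hence an MSC
    started at [p] itself that is not reversible on [M].

    Stationarity of [rho] rests on the decomposition [nu = u + w (1 - P)] with
    [u P = u] for stochastic [P]: the Abel means of [nu P^t] then differ from [u]
    by the Abel means of a telescoping bounded sequence, which are [O(a)]. *)

(** * Abel means of bounded telescoping sequences *)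

Lemma abel_telescope_bound (R : realFieldType) (b : nat -> R) (B a : R)
    (n : nat) :
  (forall t, `|b t| <= B) -> 0 <= a -> a <= 1 ->
  `|\sum_(0 <= t < n) a * (1 - a) ^+ t * (b t - b t.+1)| <= 2 * (a * B).
Proof.
move=> bB a0 a1; have x0 m : 0 <= (1 - a) ^+ m by rewrite exprn_ge0 ?subr_ge0.
have B0 : 0 <= B by exact: le_trans (bB 0).
(* Adding the boundary term of the summation by parts closes the induction: a step then changes the
   sum by [a * a * (1 - a) ^+ n * b n.+1] only, and these changes add up geometrically, whence the
   factor [2 - (1 - a) ^+ n]. *)
have aux : `|\sum_(0 <= t < n) a * (1 - a) ^+ t * (b t - b t.+1)
            + a * (1 - a) ^+ n * b n| <= a * B * (2 - (1 - a) ^+ n).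
  elim: n => [|n IHn].
    rewrite big_nil add0r expr0 mulr1 normrM ger0_norm //.
    rewrite (_ : a * B * (2 - 1) = a * B); last by ring.
    by rewrite ler_wpM2l.
  rewrite big_nat_recr //=; set S := \sum_(0 <= t < n) _ in IHn *.
  have -> : S + a * (1 - a) ^+ n * (b n - b n.+1) + a * (1 - a) ^+ n.+1 * b n.+1
    = (S + a * (1 - a) ^+ n * b n) - a * a * (1 - a) ^+ n * b n.+1.
    by rewrite exprS; ring.
  rewrite (le_trans (ler_normB _ _)) // normrM [`|a * a * _|]ger0_norm; last first.
    by rewrite !mulr_ge0.
  have -> : a * B * (2 - (1 - a) ^+ n.+1) =
    a * B * (2 - (1 - a) ^+ n) + a * a * (1 - a) ^+ n * B.
    by rewrite exprS; ring.
  by rewrite lerD // ler_wpM2l // !mulr_ge0.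
have tail : `|a * (1 - a) ^+ n * b n| <= a * (1 - a) ^+ n * B.
  by rewrite normrM ger0_norm ?mulr_ge0 // ler_wpM2l ?mulr_ge0.
set S := \sum_(0 <= t < n) _ in aux *.
have -> : S = (S + a * (1 - a) ^+ n * b n) - a * (1 - a) ^+ n * b n by ring.
rewrite (le_trans (ler_normB _ _)) // (le_trans (lerD aux tail)) //.
by rewrite le_eqVlt; apply/orP; left; apply/eqP; ring.
Qed.

Section AbelMeans.
Local Open Scope classical_set_scope.

(** The first [n] Abel weights sum to [1 - (1 - a) ^+ n]; once that multiple of [u] is removed only
    the telescoping part is left, and its bound passes to the limit. *)
Lemma abel_sum_dist (R : realType) (u : R) (b : nat -> R) (B a : R) :
  (forall t, `|b t| <= B) -> 0 < a -> a < 1 ->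
  `|limn (fun n => \sum_(0 <= t < n) a * (1 - a) ^+ t * (u + (b t - b t.+1))) - u|
    <= 2 * (a * B).
Proof.
move=> bB a0 a1.
have B0 : 0 <= B by exact: le_trans (bB 0).
have x0 : 0 <= 1 - a by rewrite subr_ge0 ltW.
have x1 : `|1 - a| < 1 by rewrite ger0_norm //; lra.
set f := fun n => _.
have cf : cvgn f.
  apply: (@normed_cvg _ _ (fun t => a * (1 - a) ^+ t * (u + (b t - b t.+1)))).
  apply: (@series_le_cvg _ _ (geometric (a * (`|u| + (B + B))) (1 - a))) => [n|n|n|] /=.
  - exact: normr_ge0.
  - apply: mulr_ge0; last exact: exprn_ge0.
    by rewrite mulr_ge0 ?(ltW a0) // !addr_ge0.
  - rewrite normrM ger0_norm ?mulr_ge0 ?exprn_ge0 ?(ltW a0) //.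
    rewrite [leRHS]mulrAC ler_wpM2l ?mulr_ge0 ?exprn_ge0 ?(ltW a0) //.
    by rewrite (le_trans (ler_normD _ _)) // lerD2l (le_trans (ler_normB _ _)) ?lerD.
  - exact: is_cvg_geometric_series.
have fE n : f n - u * (1 - (1 - a) ^+ n) =
    \sum_(0 <= t < n) a * (1 - a) ^+ t * (b t - b t.+1).
  elim: n => [|n IHn]; first by rewrite /f !big_nil expr0; ring.
  rewrite big_nat_recr //= -IHn /f big_nat_recr //= exprS; ring.
have cg : (fun n => `|f n - u * (1 - (1 - a) ^+ n)|) @ \oo --> `|limn f - u|.
  apply: cvg_norm; apply: cvgB => //.
  rewrite -[X in _ --> X]mulr1; apply: cvgMr.
  rewrite -[X in _ --> X]subr0; apply: cvgB; first exact: cvg_cst.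
  exact: cvg_expr.
rewrite -(cvg_lim _ cg) //; apply: limr_le; first by apply/cvg_ex; eexists; exact: cg.
by apply: nearW => n; rewrite fE; apply: abel_telescope_bound => //; exact: ltW.
Qed.

Lemma abel_lim (R : realType) (u : R) (b : nat -> R) (B : R) :
  (forall t, `|b t| <= B) ->
  lim ((fun a : R => limn (fun n =>
     \sum_(0 <= t < n) a * (1 - a) ^+ t * (u + (b t - b t.+1)))) @ at_right (0 : R))
  = u.
Proof.
move=> bB; have B0 : 0 <= B by exact: le_trans (bB 0).
apply: cvg_lim => //; apply/cvgrPdist_le => e e0.
near=> a; rewrite distrC (le_trans (abel_sum_dist _ bB _ _)) //.
(* [B + 1] instead of [B] keeps the denominator positive when [B = 0]. *)
have aB : a <= e / (2 * (B + 1)).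
  by near: a; apply: nbhs_right_le; rewrite divr_gt0 // mulr_gt0 ?ltr_wpDl.
have : a * (2 * (B + 1)) <= e by rewrite -ler_pdivlMr // mulr_gt0 ?ltr_wpDl.
have : 0 < a by near: a; exact: nbhs_right_gt.
by nra.
Unshelve. all: by end_near. Qed.

End AbelMeans.

(** * Stochastic matrices and the splitting along [1 - P] *)

Section StochasticMatrix.
Variables (R : realType) (n : nat).

Definition stochastic_mx (P : 'M[R]_n) : Prop :=
  (forall i j, 0 <= P i j) /\ (forall i, \sum_j P i j = 1).

(** Right multiplication by [P] does not increase the l1 norm of a row vector, and a coordinate is
    at most that norm. *)
Lemma stochastic_iter_bound (P : 'M[R]_n) (w : 'rV[R]_n) (t : nat) (j : 'I_n) :
  stochastic_mx P ->
  `|iter t (mulmxr P) w 0 j| <= \sum_k `|w 0 k|.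
Proof.
move=> [P0 P1].
have contract (v : 'rV_n) : \sum_k `|(v *m P) 0 k| <= \sum_k `|v 0 k|.
  under [leRHS]eq_bigr => i _ do rewrite -[`|_|]mulr1 -(P1 i) mulr_sumr.
  rewrite exchange_big /= ler_sum // => k _.
  rewrite mxE (le_trans (ler_norm_sum _ _ _)) // ler_sum // => i _.
  by rewrite normrM (ger0_norm (P0 i k)).
apply: (@le_trans _ _ (\sum_k `|iter t (mulmxr P) w 0 k|)).
  by rewrite (bigD1 j) //= lerDl sumr_ge0.
by elim: t => //= t IHt; exact: le_trans (contract _) IHt.
Qed.

(* [v = w (1 - P)] fixed by [P] gives [w P^t = w - t v], which is bounded in [t]
   only if [v = 0]. *)
Lemma stochastic_ker_cap_im (P : 'M[R]_n) :
  stochastic_mx P -> (kermx (1%:M - P) :&: (1%:M - P))%MS = 0.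
Proof.
move=> sP; apply/eqP/rowV0P => v; rewrite sub_capmx => /andP[/sub_kermxP vk].
move=> /submxP[w vw]; apply/rowP => j; rewrite [RHS]mxE.
have vP : v *m P = v by apply/esym/eqP; rewrite -subr_eq0 -{1}[v]mulmx1 -mulmxBr vk.
have wP : w *m P = w - v by rewrite vw mulmxBr mulmx1 opprB addrC subrK.
have itE t : iter t (mulmxr P) w = w - v *+ t.
  elim: t => [|t /= ->]; first by rewrite mulr0n subr0.
  by rewrite /mulmxr mulmxBl wP -scaler_nat -scalemxAl vP scaler_nat mulrS opprD addrA.
apply/eqP; rewrite -normr_le0 leNgt; apply/negP => vj0.
set B := \sum_k `|w 0 k| + `|w 0 j|.
have vB t : `|v 0 j| *+ t <= B.
  have := stochastic_iter_bound w t j sP; rewrite itE mxE [X in _ + X]mxE mulmxnE => h.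
  rewrite -normrMn -[v 0 j *+ t](subKr (w 0 j)) (le_trans (ler_normB _ _)) //.
  by rewrite /B addrC lerD2r.
have := vB (Num.bound (B / `|v 0 j|)); apply/negP; rewrite -ltNge -mulr_natl.
rewrite -ltr_pdivrMr //; apply: archi_boundP.
by rewrite divr_ge0 // addr_ge0 ?sumr_ge0.
Qed.

(** The kernel and the row space of [1 - P] meet trivially, so by rank-nullity they span the whole
    space; [u] is the kernel part of [nu]. *)
Lemma stochastic_decomposition (P : 'M[R]_n) (nu : 'rV[R]_n) :
  stochastic_mx P -> exists u w : 'rV[R]_n, u *m P = u /\ nu = u + (w - w *m P).
Proof.
move=> sP; set A := 1%:M - P.
have full : (1%:M <= kermx A + A)%MS.
  rewrite sub1mx; apply/eqP.
  have := mxrank_sum_cap (kermx A) A.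
  by rewrite stochastic_ker_cap_im // mxrank0 addn0 mxrank_ker subnK ?rank_leq_col.
have /sub_addsmxP[[x w] /= nuE] : (nu <= kermx A + A)%MS.
  by apply: submx_trans (submx1 nu) full.
exists (x *m kermx A), w; split.
  by apply/eqP; rewrite eq_sym -subr_eq0 -{1}[x *m _]mulmx1 -mulmxBr -mulmxA mulmx_ker mulmx0.
by rewrite nuE /A mulmxBr mulmx1.
Qed.

End StochasticMatrix.

(** * Stationarity of the Abel limit [rho] *)

Section Stationarity.
Variables (R : realType) (X : finType).
Implicit Types (Q : {set X} -> X -> X -> R) (nu : {set X} -> X -> R).
Implicit Types (M : {set X}) (f : X -> R).

Definition stochastic_on Q M : Prop :=
  (forall i j, i \in M -> j \in M -> 0 <= Q M i j) /\
  (forall i, i \in M -> \sum_(k in M) Q M i k = 1).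

Lemma MSC_stochastic Q nu M : MSC Q nu -> menu M -> stochastic_on Q M.
Proof.
move=> mQ /mQ[Q0 [_ [_ [Q1 _]]]]; split=> // i iM.
by rewrite (bigD1 i) //= (Q1 i iM).1 subrK.
Qed.

(** Row sums equal to 1 turn [f j] into the total outflow from [j], so stationarity becomes flow
    conservation. *)
Lemma stationary_flow Q M f j : stochastic_on Q M -> j \in M ->
  \sum_(i in M) f i * Q M i j = f j <->
  \sum_(k in M) (f j * Q M j k - f k * Q M k j) = 0.
Proof.
move=> [_ Q1] jM; rewrite sumrB -mulr_sumr Q1 // mulr1.
by split=> [->|/eqP]; [rewrite subrr | rewrite subr_eq0 => /eqP].
Qed.

Lemma rho_stationary Q nu M : stochastic_on Q M ->
  forall j, j \in M -> \sum_(i in M) rho Q nu M i * Q M i j = rho Q nu M j.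
Proof.
move=> [Q0 Q1]; pose P := \matrix_(i < #|M|, j < #|M|) Q M (enum_val i) (enum_val j).
have sP : stochastic_mx P.
  split=> [i j|i]; first by rewrite mxE Q0 ?enum_valP.
  under eq_bigr do rewrite mxE.
  by rewrite -(big_enum_val (fun k => Q M (enum_val i) k)) Q1 ?enum_valP.
have [u [w [uP nuE]]] :=
  stochastic_decomposition (\row_(i < #|M|) nu M (enum_val i)) sP.
pose b t (i : 'I_#|M|) := iter t (mulmxr P) w 0 i.
have nuQtE t i : nuQt Q nu M t (enum_val i) = u 0 i + (b t i - b t.+1 i).
  have -> : u 0 i + (b t i - b t.+1 i) =
     (u + (iter t (mulmxr P) w - iter t.+1 (mulmxr P) w)) 0 i by rewrite mxE [X in _ = _ + X]mxE [X in _ = _ + (_ + X)]mxE.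
  elim: t i => [|t IHt] i /=.
    by rewrite -nuE mxE.
  rewrite (big_enum_val (fun k => nuQt Q nu M t k * Q M k (enum_val i))).
  rewrite -{1}uP -mulmxBl -mulmxDl mxE.
  by apply: eq_bigr => k _; rewrite IHt [P _ _]mxE.
have rhoE i : rho Q nu M (enum_val i) = u 0 i.
  rewrite /rho; under eq_fun do under eq_fun do under eq_bigr do rewrite nuQtE.
  exact: (abel_lim _ (fun t => stochastic_iter_bound w t i sP)).
move=> j jM; rewrite -(enum_rankK_in jM jM).
rewrite (big_enum_val (fun k => rho Q nu M k * Q M k _)) rhoE -[in RHS]uP [RHS]mxE.
by apply: eq_bigr => k _; rewrite rhoE [P _ _]mxE.
Qed.

(** The sequence [nu Q^t] is constant on [M], which is the Abel limit with [b = 0]. *)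
Lemma rho_of_stationary Q nu M :
  (forall j, j \in M -> \sum_(i in M) nu M i * Q M i j = nu M j) ->
  forall j, j \in M -> rho Q nu M j = nu M j.
Proof.
move=> st j jM.
have nuQtE t i : i \in M -> nuQt Q nu M t i = nu M i + (0 - 0).
  elim: t i => [|t IHt] i iM /=; rewrite subrr addr0 //.
  by rewrite -[RHS]st //; apply: eq_bigr => k kM; rewrite IHt // subrr addr0.
rewrite /rho; under eq_fun do under eq_fun do under eq_bigr do rewrite nuQtE //.
by apply: (@abel_lim R _ (fun=> 0) 0) => _; rewrite normr0.
Qed.

End Stationarity.

(** * Cycles as lists, and cycles inside circulations *)

Section CyclePairs.
Variables (X : finType).

Lemma all_cycle_pairs (e : rel X) (s : seq X) :
  cycle e s <-> (forall kl, kl \in cycle_pairs s -> e kl.1 kl.2).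
Proof.
suff -> : cycle e s = all (fun kl => e kl.1 kl.2) (cycle_pairs s).
  by split=> [/allP|?]; last exact/allP.
case: s => // x t; rewrite /cycle_pairs rot1_cons /=.
(* The closing vertex is separated from the head, so that the induction can advance the head while
   the cycle still returns to [y]. *)
move: {2 4}x => y.
by elim: t x => [|z t IHt] x //=; rewrite IHt.
Qed.

Lemma cycle_pairs_head (x : X) (t : seq X) :
  exists y, (x, y) \in cycle_pairs (x :: t).
Proof.
rewrite /cycle_pairs rot1_cons; case: t => [|y t] /=.
  by exists x; rewrite inE.
by exists y; rewrite inE eqxx.
Qed.

End CyclePairs.

(* The edges leaving the set [S] reachable from [j] along positive edges all
   carry nonpositive flow, but the flow out of [S] is zero: hence if [G i j > 0]
   then [i] is in [S]. *)
Lemma circulation_cycle (R : realDomainType) (X : finType) (M : {set X})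
    (G : X -> X -> R) :
  (forall i j, G i j = - G j i) ->
  (forall i, i \in M -> \sum_(j in M) G i j = 0) ->
  forall i j, i \in M -> j \in M -> 0 < G i j ->
  exists s, is_cycle_in M s /\ cycle (fun a b => 0 < G a b) s.
Proof.
move=> antiG sumG i j iM jM Gij.
pose e := [rel a b | (a \in M) && (b \in M) && (0 < G a b)].
pose S := connect e j.
have SM a : S a -> a \in M.
  move=> /connectP[q]; elim/last_ind: q => [|q b _] /= pq -> //.
  by move: pq; rewrite rcons_path last_rcons => /andP[_ /andP[/andP[_ ->]]].
have step a b : S a -> b \in M -> ~~ S b -> G a b <= 0.
  move=> Sa bM; apply: contraNle => Gab; apply: (connect_trans Sa).
  by apply: connect1; rewrite /= (SM a) ?bM ?Gab.
have Si : S i.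
  apply: contraT => nSi.
  (* Flow between members of [S] cancels in pairs by antisymmetry, so the flow leaving [S] inside
     [M] must sum to zero. *)
  have inner : \sum_(a in M | S a) \sum_(b in M | S b) G a b = 0.
    set I := LHS; suff /eqP : I *+ 2 = 0 by rewrite mulrn_eq0 => /eqP.
    rewrite mulr2n {2}/I exchange_big /= -big_split /=.
    rewrite big1 // => a _; rewrite -big_split /= big1 // => b _.
    by rewrite antiG addNr.
  have : \sum_(a in M | S a) \sum_(b in M | ~~ S b) G a b = 0.
    rewrite -[LHS]add0r -{1}inner -big_split /= big1 // => a /andP[aM _].
    by rewrite -(bigID S) sumG.
  (* Were [i] outside [S], the edge from [j] to [i] would leave [S] with flow [- G i j < 0], and no
     other leaving edge could compensate for it. *)
  rewrite (bigD1 j) /=; last by rewrite jM /S connect0.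
  rewrite (bigD1 i) /=; last by rewrite iM.
  move=> /eqP; rewrite lt_eqF // -addrA; apply: ltr_nwDl.
    by rewrite antiG oppr_lt0.
  rewrite -[leRHS]addr0; apply: lerD; first by apply: sumr_le0 => b /andP[/andP[bM nSb] _]; rewrite step // /S connect0.
  apply: sumr_le0 => a /andP[/andP[aM Sa] _].
  by apply: sumr_le0 => b /andP[bM nSb]; rewrite step.
move/connectP: Si => [q0 pq0 iE]; case/shortenP: pq0 iE => q pq uq _ iE.
have sM : {subset j :: q <= M}.
  by move=> a aq; apply: SM; exact: path_connect pq _ aq.
exists (j :: q); split; first by split.
rewrite /= rcons_path -iE Gij andbT.
by apply: (sub_path _ pq) => a b /andP[].
Qed.

(** * Acyclicity of [delta] implies reversibility *)

Section Choice.
Variables (R : realType) (X : finType) (p : X -> {set X} -> R).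
Hypothesis sp : stoch_choice p.
Implicit Types (M N : {set X}) (i j : X).

Lemma in_menu M i : i \in M -> menu M.
Proof. by move=> iM; apply/set0Pn; exists i. Qed.

Lemma delta_anti M i j : delta p M i j = - delta p M j i.
Proof. by rewrite /delta (finset.setUC [set j]) opprB mulrC [X in _ - X]mulrC. Qed.

Lemma delta_refl M i : delta p M i i = 0.
Proof. by rewrite /delta mulrC subrr. Qed.

Lemma delta_pair i j : delta p [set i; j] i j = 0.
Proof. by rewrite /delta subrr. Qed.

Lemma choice_pair_sum i j : i != j -> p i [set i; j] + p j [set i; j] = 1.
Proof.
move=> ij; have [_ [<- _]] := sp (in_menu (set21 i j)).
by rewrite big_setU1 ?inE //= big_set1.
Qed.

(** Stationarity on [{i,j}] is detailed balance there, so the binary rates are in the ratio of the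
    binary choice probabilities. (A3) carries this ratio over to [Q M], with symmetric weight
    [Q M i j + Q M j i]. *)
Lemma flow_delta Q nu M i j : MSC Q nu -> rationalizes p Q nu ->
  i \in M -> j \in M ->
  p i M * Q M i j - p j M * Q M j i = (Q M i j + Q M j i) * delta p M i j.
Proof.
move=> mQ rQ iM jM; have [->|ij] := eqVneq i j.
  by rewrite delta_refl mulr0 subrr.
have mij := in_menu (set21 i j).
have [Q0 [_ [_ [Q1 [A2 _]]]]] := mQ _ mij.
have [_ [_ [_ [_ [_ A3]]]]] := mQ _ (in_menu iM).
have bal : p i [set i; j] * Q [set i; j] i j = p j [set i; j] * Q [set i; j] j i.
  have st : \sum_(k in [set i; j]) p k [set i; j] * Q [set i; j] k i = p i [set i; j].
    rewrite [RHS](rQ _ mij) ?set21 // -(rho_stationary nu (MSC_stochastic mQ mij)) ?set21 //.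
    by apply: eq_bigr => k kij; rewrite (rQ _ mij).
  have := (stationary_flow (p^~ [set i; j]) (MSC_stochastic mQ mij) (set21 i j)).1 st.
  by rewrite big_setU1 ?inE //= big_set1 /= subrr add0r => /eqP; rewrite subr_eq0 => /eqP.
(* (A2) excludes that both binary rates vanish, so their sum can be cancelled. *)
have pos : 0 < Q [set i; j] i j + Q [set i; j] j i.
  have := Q0 _ _ (set21 i j) (set22 i j); have := Q0 _ _ (set22 i j) (set21 i j).
  move=> h1; rewrite le_eqVlt => /predU1P[/esym h2|h2]; last by rewrite ltr_pwDl.
  by rewrite ltr_wpDl ?h2 // A2 ?set21 ?set22.
have := A3 _ _ iM jM ij; have := choice_pair_sum ij.
rewrite /delta.
move: bal pos; move: (Q [set i; j] i j) (Q [set i; j] j i) => a b.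
move: (p i [set i; j]) (p j [set i; j]) (Q M i j) (Q M j i) (p i M) (p j M).
move=> Pi Pj q r x y bal pos P1 A.
have aE : a = Pj * (a + b) by rewrite mulrDr -bal -mulrDl [Pj + _]addrC P1 mul1r.
have bE : b = Pi * (a + b) by rewrite mulrDr bal -mulrDl [Pj + _]addrC P1 mul1r.
have {A} : Pj * r = Pi * q.
  apply: (mulIf (lt0r_neq0 pos)); rewrite mulrAC -aE [RHS]mulrAC -bE //.
move=> E.
have qE : q = Pj * (q + r) by rewrite mulrDr E -mulrDl [Pj + _]addrC P1 mul1r.
have rE : r = Pi * (q + r) by rewrite mulrDr -E -mulrDl [Pj + _]addrC P1 mul1r.
rewrite {1}qE {2}rE; ring.
Qed.

(** A positive net flow would lie in a circulation, giving a cycle of positive flow; the weights in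
    [flow_delta] being nonnegative, [delta] would be positive along it. So no flow is positive, and
    by antisymmetry all vanish. *)
Lemma reversible_of_acyclic Q nu M :
  (~ exists s, is_cycle_in M s /\ cycle (fun a b => 0 < delta p M a b) s) ->
  MSC Q nu -> rationalizes p Q nu -> reversible Q nu M.
Proof.
move=> acyc mQ rQ i j iM jM; have mM := in_menu iM.
have sQ := MSC_stochastic mQ mM.
pose G a b := if (a \in M) && (b \in M) then p a M * Q M a b - p b M * Q M b a else 0.
have GM a b : a \in M -> b \in M -> G a b = p a M * Q M a b - p b M * Q M b a.
  by rewrite /G => -> ->.
have antiG a b : G a b = - G b a.
  by rewrite /G andbC; case: ifP => _; rewrite ?oppr0 ?opprB.
have sumG a : a \in M -> \sum_(b in M) G a b = 0.
  move=> aM; under eq_bigr do rewrite GM //.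
  apply: (stationary_flow (p^~ M) sQ aM).1.
  rewrite [RHS](rQ _ mM) // -(rho_stationary nu sQ) //.
  by apply: eq_bigr => k kM; rewrite (rQ _ mM).
have G0 a b : a \in M -> b \in M -> G a b <= 0.
  move=> aM bM; rewrite leNgt; apply/negP => Gab.
  have [s [cs Gs]] := circulation_cycle antiG sumG aM bM Gab.
  apply: acyc; exists s; split=> //.
  have [_ _ /allP sM] := cs.
  apply: (sub_in_cycle (P := mem M)) sM Gs => c d cM dM.
  rewrite GM // (flow_delta mQ rQ) // => h.
  have [Q0 _] := sQ; apply: contraTT h; rewrite -!leNgt => h.
  by rewrite mulr_ge0_le0 // addr_ge0 // Q0.
have /eqP : G i j = 0.
  by apply/eqP; rewrite eq_le G0 //= antiG oppr_ge0 G0.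
by rewrite GM // subr_eq0 -!(rQ _ mM) // => /eqP ->; rewrite mulrC.
Qed.

Lemma card2_pair (N : {set X}) i j : #|N| = 2%N -> i \in N -> j \in N -> i != j ->
  N = [set i; j].
Proof.
move=> N2 iN jN ij; apply/esym/eqP; rewrite eqEcard N2 cards2 ij andbT.
by apply/fintype.subsetP => k; rewrite !inE => /orP[] /eqP ->.
Qed.

(* On menu [N] the weight of an edge is multiplied by the binary choice
   probability of its endpoint, which is what (A3) forces. *)
Definition weighted_Q (L : {set X} -> X -> X -> R) (N : {set X}) i j : R :=
  if i == j then 1 - \sum_(k in N | k != i) L N i k * p k [set i; k]
  else L N i j * p j [set i; j].

(** * The MSC defined by symmetric edge weights *)

Section WeightedMSC.
Variable L : {set X} -> X -> X -> R.
Hypothesis L_ge0 : forall N i j, 0 <= L N i j.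
Hypothesis L_sym : forall N i j, L N i j = L N j i.
Hypothesis L_sum_lt1 : forall (N : {set X}) i, i \in N ->
  \sum_(k in N | k != i) L N i k < 1.
Hypothesis L_pair_gt0 : forall i j, i != j -> 0 < L [set i; j] i j.
Hypothesis L_circulation : forall (N : {set X}) i, i \in N ->
  \sum_(j in N) L N i j * delta p N i j = 0.

Lemma choice_pair_ge0 i j : 0 <= p j [set i; j].
Proof. by have [/(_ j)/andP[]] := sp (in_menu (set21 i j)). Qed.

Lemma choice_pair_le1 i j : p j [set i; j] <= 1.
Proof. by have [/(_ j)/andP[]] := sp (in_menu (set21 i j)). Qed.

Lemma weighted_Q_diag N i : weighted_Q L N i i =
  1 - \sum_(k in N | k != i) weighted_Q L N i k.
Proof.
rewrite {1}/weighted_Q eqxx; congr (1 - _); apply: eq_bigr => k /andP[_ ki].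
by rewrite /weighted_Q eq_sym (negbTE ki).
Qed.

Lemma weighted_Q_diag_gt0 (N : {set X}) i : i \in N -> 0 < weighted_Q L N i i.
Proof.
move=> iN; rewrite /weighted_Q eqxx subr_gt0 (le_lt_trans _ (L_sum_lt1 iN)) //.
by apply: ler_sum => k _; rewrite ler_piMr // choice_pair_le1.
Qed.

Lemma weighted_Q_ge0 (N : {set X}) i j : i \in N -> 0 <= weighted_Q L N i j.
Proof.
move=> iN; have [->|ij] := eqVneq j i; first exact/ltW/weighted_Q_diag_gt0.
by rewrite /weighted_Q eq_sym (negbTE ij) mulr_ge0 // choice_pair_ge0.
Qed.

Lemma weighted_Q_stochastic N : stochastic_on (weighted_Q L) N.
Proof.
split=> [i j iN _|i iN]; first exact: weighted_Q_ge0.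
by rewrite (bigD1 i) //= weighted_Q_diag subrK.
Qed.

(** (A2) holds because the two binary choice probabilities sum to 1 and cannot both vanish; (A3)
    because symmetry of [L] makes its two sides the same product. *)
Lemma weighted_MSC : MSC (weighted_Q L) (fun N j => p j N).
Proof.
move=> N mN; have [p01 [p1 p0]] := sp mN.
split; first by move=> i j iN _; exact: weighted_Q_ge0.
split; first by move=> i _; have /andP[] := p01 i.
split=> //; split; first by move=> i iN; split; [exact: weighted_Q_diag|exact: weighted_Q_diag_gt0].
split=> [i j _ _ ij|i j _ _ ij].
  have Lij := L_pair_gt0 ij.
  rewrite /weighted_Q (negbTE ij) eq_sym (negbTE ij) => /eqP.
  rewrite mulf_eq0 (gt_eqF Lij) /= => /eqP pj0.
  have := choice_pair_sum ij; rewrite pj0 addr0 => pi1.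
  by rewrite (finset.setUC [set j]) pi1 mulr1 L_sym.
rewrite /weighted_Q (negbTE ij) eq_sym (negbTE ij) (finset.setUC [set j]).
by rewrite (L_sym N j) (L_sym _ j); ring.
Qed.

Lemma weighted_flow N i j :
  p i N * weighted_Q L N i j - p j N * weighted_Q L N j i = L N i j * delta p N i j.
Proof.
have [->|ij] := eqVneq i j; first by rewrite delta_refl mulr0 subrr.
rewrite /weighted_Q /delta (negbTE ij) eq_sym (negbTE ij) (finset.setUC [set j]).
by rewrite (L_sym N j); ring.
Qed.

Lemma weighted_rho N j : j \in N -> rho (weighted_Q L) (fun N j => p j N) N j = p j N.
Proof.
move=> jN; apply: (rho_of_stationary (nu := fun N j => p j N)) (jN) => i iN.
apply/(stationary_flow _ (weighted_Q_stochastic N) iN).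
by under eq_bigr do rewrite weighted_flow; exact: L_circulation.
Qed.

Lemma weighted_reversible N i j : reversible (weighted_Q L) (fun N j => p j N) N ->
  i \in N -> j \in N -> L N i j * delta p N i j = 0.
Proof.
move=> rev iN jN; rewrite -weighted_flow; apply/eqP; rewrite subr_eq0.
by have := rev i j iN jN; rewrite !weighted_rho // [p j N * _]mulrC => ->.
Qed.

End WeightedMSC.

(** * A non-reversible MSC from a positive cycle *)

Section NonReversible.
Variables (M : {set X}) (s : seq X).
Hypotheses (us : uniq s) (sM : {subset s <= M}).
Hypothesis (pos_cycle : cycle (fun a b => 0 < delta p M a b) s).

Definition cycle_arc i j : R := ((i \in s) && (j == next s i))%:R.

(** Symmetrized and scaled so that every arc carries net flow 1. Where [delta] is zero, division by
    zero gives weight 0, which is harmless since no arc lies there. *)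
Definition cycle_weight i j : R :=
  (cycle_arc i j + cycle_arc j i) / `|delta p M i j|.

(** Dividing by it makes every row sum of weights on [M] less than 1; the summand 1 gives strictness
    and positivity. *)
Definition cycle_total : R := 1 + \sum_(i in M) \sum_(j in M) cycle_weight i j.

(** Away from [M], a two-element menu needs a positive weight for (A2), and any constant below 1 is
    a circulation there as [delta] vanishes on it. On other menus weight 0 gives the identity
    matrix, which fixes [p]. *)
Definition edge_weight (N : {set X}) i j : R :=
  if N == M then cycle_weight i j / cycle_total
  else if #|N| == 2%N then 1 / 2 else 0.

Lemma cycle_delta_pos i : i \in s -> 0 < delta p M i (next s i).
Proof. exact: (next_cycle pos_cycle). Qed.

Lemma cycle_arc_delta i j : cycle_arc i j * delta p M i j = cycle_arc i j * `|delta p M i j|.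
Proof.
rewrite /cycle_arc; case: andP => [[iS /eqP ->]|_]; last by rewrite !mul0r.
by rewrite gtr0_norm // cycle_delta_pos.
Qed.

Lemma cycle_weight_ge0 i j : 0 <= cycle_weight i j.
Proof. by rewrite divr_ge0 // addr_ge0 ?ler0n. Qed.

Lemma cycle_weightC i j : cycle_weight i j = cycle_weight j i.
Proof. by rewrite /cycle_weight addrC delta_anti normrN. Qed.

Lemma cycle_weight_delta i j :
  cycle_weight i j * delta p M i j = cycle_arc i j - cycle_arc j i.
Proof.
have [d0|d0] := eqVneq (delta p M i j) 0.
  rewrite d0 mulr0 /cycle_arc.
  case: andP => [[iS /eqP jE]|_]; first by have := cycle_delta_pos iS; rewrite -jE d0 ltxx.
  case: andP => [[jS /eqP iE]|_]; last by rewrite subrr.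
  by have := cycle_delta_pos jS; rewrite -iE delta_anti d0 oppr0 ltxx.
have n0 : `|delta p M i j| != 0 by rewrite normr_eq0.
have := cycle_arc_delta j i; rewrite delta_anti normrN mulrN => /eqP.
rewrite eqr_oppLR => /eqP h.
rewrite /cycle_weight mulrAC mulrDl cycle_arc_delta h -mulNr -mulrDl mulfK //.
Qed.

(** A vertex of the cycle has one arc out, to its [next], and one arc in, from its [prev]; other
    vertices have none. *)
Lemma cycle_weight_circulation i :
  \sum_(j in M) cycle_weight i j * delta p M i j = 0.
Proof.
under eq_bigr do rewrite cycle_weight_delta.
rewrite sumrB; apply/eqP; rewrite subr_eq0; apply/eqP.
have [iS|iS] := boolP (i \in s); last first.
  rewrite !big1 // => j _; rewrite /cycle_arc ?(negbTE iS) //.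
  by case: eqP => [iE|_]; rewrite ?andbF // andbT -mem_next -iE (negbTE iS).
transitivity (1 : R).
  rewrite (bigD1 (next s i)) /=; last by rewrite sM // mem_next.
  rewrite /cycle_arc iS eqxx big1 ?addr0 // => j /andP[_ /negbTE ->] //.
rewrite (bigD1 (prev s i)) /=; last by rewrite sM // mem_prev.
rewrite /cycle_arc mem_prev iS next_prev // eqxx big1 ?addr0 // => j /andP[_ ji].
by case: eqP => [iE|]; rewrite ?andbF //; rewrite iE prev_next // eqxx in ji.
Qed.

Lemma cycle_total_gt0 : 0 < cycle_total.
Proof.
rewrite ltr_pwDl // sumr_ge0 // => i _; apply: sumr_ge0 => j _.
exact: cycle_weight_ge0.
Qed.

Lemma edge_weight_ge0 N i j : 0 <= edge_weight N i j.
Proof.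
rewrite /edge_weight; case: ifP => _; last by case: ifP.
by rewrite divr_ge0 ?cycle_weight_ge0 // ltW // cycle_total_gt0.
Qed.

Lemma edge_weightC N i j : edge_weight N i j = edge_weight N j i.
Proof. by rewrite /edge_weight cycle_weightC. Qed.

Lemma edge_weight_sum_lt1 (N : {set X}) i : i \in N ->
  \sum_(k in N | k != i) edge_weight N i k < 1.
Proof.
move=> iN; rewrite /edge_weight; have [NM|_] := eqVneq N M.
  rewrite -mulr_suml ltr_pdivrMr ?cycle_total_gt0 // mul1r /cycle_total -NM.
  rewrite (bigD1 i iN) /= (bigD1 i iN) /=; set S := \sum_(k in N | k != i) cycle_weight i k.
  set T := \sum_(_ | _) _ in S *; set U := \sum_(k in N | _) \sum_(_ in _) _.
  have U0 : 0 <= U by apply: sumr_ge0 => k _; apply: sumr_ge0 => l _; exact: cycle_weight_ge0.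
  by have := cycle_weight_ge0 i i; lra.
case: eqP => [/eqP N2|_]; last by rewrite big1.
have /card_gt1P : (1 < #|N|)%N by rewrite (eqP N2).
have: (0 < #|N :\ i|)%N by move: N2; rewrite (cardsD1 i) iN; case: #|_|.
move=> /card_gt0P[j]; rewrite !inE => /andP[ji jN] _.
rewrite (card2_pair (eqP N2) iN jN) 1?eq_sym //.
rewrite (bigD1 j) /=; last by rewrite !inE eqxx orbT ji.
rewrite big1 ?addr0; first by lra.
by move=> k /andP[/andP[]]; rewrite !inE => /orP[] ->.
Qed.

Lemma edge_weight_circulation (N : {set X}) i : i \in N ->
  \sum_(j in N) edge_weight N i j * delta p N i j = 0.
Proof.
move=> iN; rewrite /edge_weight; have [->|_] := eqVneq N M.
  under eq_bigr do rewrite mulrAC.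
  by rewrite -mulr_suml cycle_weight_circulation mul0r.
apply: big1 => j jN; case: eqP => [N2|_]; last by rewrite mul0r.
have [->|ij] := eqVneq i j; first by rewrite delta_refl mulr0.
by rewrite (card2_pair N2 iN jN ij) delta_pair mulr0.
Qed.

(** A positive cycle contains no loop and no step back, since [delta] is antisymmetric. Hence [M] is
    not a binary menu, and all binary menus get weight 1/2 although [edge_weight] tests [N == M]
    first. *)
Lemma cycle_card_neq2 : s != [::] -> #|M| != 2%N.
Proof.
case: s us sM cycle_delta_pos => // x t _ tM dpos _.
have xs : x \in x :: t by rewrite mem_head.
set y := next (x :: t) x; have ys : y \in x :: t by rewrite mem_next.
have zs : next (x :: t) y \in x :: t by rewrite mem_next.
have dxy := dpos x xs; have dyz := dpos y ys; rewrite -/y in dxy.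
apply/eqP => M2; have xy : x != y.
  by apply: contraTneq dxy => <-; rewrite delta_refl ltxx.
have : next (x :: t) y \in [set x; y] by rewrite -(card2_pair M2 _ _ xy) ?tM.
rewrite !inE => /orP[] /eqP zE; move: dyz; rewrite zE.
  by rewrite delta_anti oppr_gt0 ltNge (ltW dxy).
by rewrite delta_refl ltxx.
Qed.

End NonReversible.

Lemma acyclic_of_reversible M :
  (forall Q nu, MSC Q nu -> rationalizes p Q nu -> reversible Q nu M) ->
  ~ exists s, is_cycle_in M s /\ cycle (fun a b => 0 < delta p M a b) s.
Proof.
move=> rev [s [[s0 us sM] pos]].
pose L := edge_weight M s.
have L_sum := edge_weight_sum_lt1 M s.
have L_circ := edge_weight_circulation us sM pos.
have L_pair i j : i != j -> 0 < L [set i; j] i j.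
  move=> ij; have c2 : #|[set i; j]| = 2%N by rewrite cards2 ij.
  rewrite /L /edge_weight c2 eqxx; case: eqP => [ME|_]; last by lra.
  by move: (cycle_card_neq2 us sM pos s0); rewrite -ME c2.
have Q_rev := rev _ _
  (weighted_MSC (edge_weight_ge0 M s) (edge_weightC M s) L_sum L_pair) _.
have /hasP[x xs _] : has predT s by rewrite has_predT lt0n size_eq0.
have ns : next s x \in s by rewrite mem_next.
have dx := cycle_delta_pos pos xs.
(* Reversibility would force zero net flow on an arc of the cycle, where both factors are
   positive. *)
have : L M x (next s x) * delta p M x (next s x) = 0.
  apply: (weighted_reversible (edge_weight_ge0 M s) (edge_weightC M s) L_sum L_circ); rewrite ?sM //.
  apply: Q_rev => N mN j jN.
  by rewrite (weighted_rho (edge_weight_ge0 M s) (edge_weightC M s) L_sum L_circ).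
apply/eqP; rewrite mulf_neq0 ?gt_eqF // /L /edge_weight eqxx.
rewrite divr_gt0 ?cycle_total_gt0 // divr_gt0 ?normr_gt0 ?gt_eqF //.
by rewrite ltr_pwDl // /cycle_arc ?xs ?eqxx ?ltr01 ?ler0n.
Qed.

End Choice.

(** * Sign-consistent cycles and reversal of orientation *)

Section SignedCycles.
Variables (R : realType) (X : finType) (p : X -> {set X} -> R) (M : {set X}).

Lemma rev_delta_cycle (s : seq X) :
  cycle (fun a b => 0 < delta p M a b) (rev s) =
  cycle (fun a b => delta p M a b < 0) s.
Proof.
by rewrite rev_cycle; apply: eq_cycle => a b; rewrite delta_anti oppr_gt0.
Qed.

Lemma no_signed_cycle :
  (~ exists s, is_cycle_in M s /\ cycle (fun a b => 0 < delta p M a b) s) <->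
  ~ (exists s : seq X, is_cycle_in M s /\
        ((forall kl, kl \in cycle_pairs s -> 0 < delta p M kl.1 kl.2) \/
         (forall kl, kl \in cycle_pairs s -> delta p M kl.1 kl.2 < 0))).
Proof.
split=> nex [s [cs h]]; apply: nex; last first.
  by exists s; split=> //; left; apply/(all_cycle_pairs (fun a b => 0 < delta p M a b)).
case: h => h; first by exists s; split=> //; exact/all_cycle_pairs.
exists (rev s); split; last by rewrite rev_delta_cycle; apply/all_cycle_pairs.
case: cs => s0 us sM; split; last by move=> x; rewrite mem_rev; exact: sM.
- by rewrite -size_eq0 size_rev size_eq0.
- by rewrite rev_uniq.
Qed.

(** One nonzero [delta] on a sign-consistent cycle spreads its strict sign to all pairs. Conversely
    a cycle has at least one pair, a loop if it has one vertex, so a strict sign is incompatible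
    with [delta] vanishing. *)
Lemma sign_consistent_zero :
  (forall s : seq X, is_cycle_in M s -> sign_consistent p M s ->
      forall kl, kl \in cycle_pairs s -> delta p M kl.1 kl.2 = 0)
   <->
   ~ (exists s : seq X, is_cycle_in M s /\
        ((forall kl, kl \in cycle_pairs s -> 0 < delta p M kl.1 kl.2) \/
         (forall kl, kl \in cycle_pairs s -> delta p M kl.1 kl.2 < 0))).
Proof.
split=> [z [s [cs h]]|nex s cs sc kl kls].
  have [y xy] : exists kl, kl \in cycle_pairs s.
    by case: s cs {h} => [[]|x t _] //; have [y] := cycle_pairs_head x t; exists (x, y).
  have : sign_consistent p M s.
    move=> a b ain bin.
    by case: h => h; rewrite ?(gtr0_sg (h _ ain)) ?(gtr0_sg (h _ bin)) // !ltr0_sg ?h.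
  move=> /(z s cs) /(_ y xy) d0.
  by case: h => /(_ y xy); rewrite d0 ltxx.
have [dn|dp|//] := ltgtP (delta p M kl.1 kl.2) 0; case: nex; exists s; split=> //.
- by right=> ab abs; rewrite -sgr_lt0 (sc _ _ abs kls) sgr_lt0.
- by left=> ab abs; rewrite -sgr_gt0 (sc _ _ abs kls) sgr_gt0.
Qed.

End SignedCycles.

Unset Implicit Arguments.

Theorem theorem1 (R : realType) (X : finType) (p : X -> {set X} -> R)
    (M : {set X}) :
  stoch_choice p -> menu M ->
  ((forall (Q : {set X} -> X -> X -> R) (nu : {set X} -> X -> R),
      MSC Q nu -> rationalizes p Q nu -> reversible Q nu M)
   <->
   (forall s : seq X, is_cycle_in M s -> sign_consistent p M s ->
      forall kl, kl \in cycle_pairs s -> delta p M kl.1 kl.2 = 0))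
  /\
  ((forall s : seq X, is_cycle_in M s -> sign_consistent p M s ->
      forall kl, kl \in cycle_pairs s -> delta p M kl.1 kl.2 = 0)
   <->
   ~ (exists s : seq X, is_cycle_in M s /\
        ((forall kl, kl \in cycle_pairs s -> 0 < delta p M kl.1 kl.2) \/
         (forall kl, kl \in cycle_pairs s -> delta p M kl.1 kl.2 < 0)))).
Proof.
move=> sp mM; split; last exact: sign_consistent_zero.
split=> [/(acyclic_of_reversible sp) acyc|/sign_consistent_zero nsc Q nu].
  exact/sign_consistent_zero/no_signed_cycle.
exact/(reversible_of_acyclic sp)/no_signed_cycle.
Qed.
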